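(* The set of maps $$\widehat{\square} = \{\phi:[m]\to[n]\in \widehat{\square}_S\mid \forall\, \delta:[p]\to [m]\in \square,\ \phi\delta \text{ one-to-one }\Rightarrow \phi\delta\in \square\}$$ is closed under composition and contains all identities of $\widehat{\square}_S$. There are the inclusions $\square\subset \widehat{\square} \subset \widehat{\square}_S$; in other terms, $\widehat{\square}$ is a well-defined category of cubes. The only one-to-one functions of $\widehat{\square}$ are the maps of $\square$. In particular, for all $n\geq 0$, the only bijective map of $\widehat{\square}([n],[n])$ is $\mathrm{Id}_{[n]}$: $\widehat{\square}$ does not contain any symmetry map.
   Context: For $n\geq 0$, $[n]=\{0<1\}^n$ with the product order, $[0]=\{()\}$. $\mathbf{PoSet}^+$ is the category of posets and strictly increasing maps. For $1\leq i\leq n$ and $\alpha\in\{0,1\}$, the coface map $\delta_i^\alpha:[n-1]\to[n]$ is $\delta_i^\alpha(x_1,\dots,x_{n-1})=(x_1,\dots,x_{i-1},\alpha,x_i,\dots,x_{n-1})$. $\square$ is the subcategory of $\mathbf{PoSet}^+$ with objects the $[n]$, $n\ge 0$, generated by the coface maps. For $x,x'\in[n]$ put $\vec d_1(x,x')=\sum_i|x_i-x'_i|$ if $x\leq x'$ and $\vec d_1(x,x')=\infty$ otherwise. A strictly increasing map $f:[m]\to[n]$ is cotransverse if for all $x,y\in[m]$, $\vec d_1(x,y)=1$ implies $\vec d_1(f(x),f(y))=1$. $\widehat{\square}_S$ is the category with objects the $[n]$, $n\geq 0$, and morphisms the cotransverse maps. A category of cubes is a small category $\mathcal{A}$ with $\square\subset\mathcal{A}\subset\widehat{\square}_S$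 (same objects). The symmetry maps are the maps $\sigma_i:[n]\to[n]$ ($n\geq2$, $1\leq i\leq n-1$) exchanging the coordinates $x_i$ and $x_{i+1}$. *)

(* Defs.v *)
From mathcomp Require Import all_boot all_order all_fingroup all_algebra.

Set Implicit Arguments.
Unset Strict Implicit.
Unset Printing Implicit Defensive.

(* n.-tupleprod bool is n.-tuple bool with the library's product order, where
   bool carries the order false < true; false and true stand for 0 and 1. *)
Definition cube (n : nat) := n.-tupleprod bool.

(* Finite functions, so that Leibniz equality of maps is extensional. *)
Definition cube_map (m n : nat) := {ffun cube m -> cube n}.

Definition id_map (n : nat) : cube_map n n := [ffun x => x].

Definition comp_map (m n p : nat) (g : cube_map n p) (f : cube_map m n) :
    cube_map m p :=
  [ffun x => g (f x)].

Definition strictly_increasing (m n : nat) (f : cube_map m n) : Prop :=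
  forall x y : cube m, (x < y)%O -> (f x < f y)%O.

(* Coordinates are numbered from 0: [coface i a] is delta_(i+1)^a.  Reading
   [unlift i k]: it is None when k = i, and otherwise the position that the
   k-th coordinate had before the insertion of a at position i. *)
Definition coface (n : nat) (i : 'I_n.+1) (a : bool) : cube_map n n.+1 :=
  [ffun x : cube n =>
    ([tuple if unlift i k is Some j then tnth x j else a | k < n.+1]
       : cube n.+1)].

(* [symmetry_map i] is sigma_(i+1) on the (n+2)-cube; [lift ord0 i] has
   value i+1. *)
Definition symmetry_map (n : nat) (i : 'I_n.+1) : cube_map n.+2 n.+2 :=
  [ffun x : cube n.+2 =>
    ([tuple tnth x (tperm (widen_ord (leqnSn n.+1) i) (lift ord0 i) k)
       | k < n.+2] : cube n.+2)].

(* Valued in nat extended with infinity, which is None. *)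
Definition d1 (n : nat) (x y : cube n) : option nat :=
  if (x <= y)%O then Some (\sum_(i < n) `|tnth x i - tnth y i|)%N else None.

Definition cotransverse (m n : nat) (f : cube_map m n) : Prop :=
  strictly_increasing f /\
  forall x y : cube m, d1 x y = Some 1%N -> d1 (f x) (f y) = Some 1%N.

Definition map_class := forall m n : nat, cube_map m n -> Prop.

Definition sub_class (A B : map_class) : Prop :=
  forall (m n : nat) (f : cube_map m n), A m n f -> B m n f.

Definition contains_identities (A : map_class) : Prop :=
  forall n : nat, A n n (id_map n).

Definition closed_under_composition (A : map_class) : Prop :=
  forall (m n p : nat) (f : cube_map m n) (g : cube_map n p),
    A m n f -> A n p g -> A m p (comp_map g f).

Inductive box : map_class :=
| box_id (n : nat) : box (id_map n)
| box_coface (n : nat) (i : 'I_n.+1) (a : bool) : box (coface i a)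
| box_comp (m n p : nat) (f : cube_map m n) (g : cube_map n p) :
    box f -> box g -> box (comp_map g f).

Definition hat_box_S : map_class := fun m n f => cotransverse f.

Definition category_of_cubes (A : map_class) : Prop :=
  [/\ contains_identities A, closed_under_composition A,
      sub_class box A & sub_class A hat_box_S].

Definition hat_box : map_class := fun m n phi =>
  hat_box_S phi /\
  forall (p : nat) (delta : cube_map p m), box delta ->
    injective (comp_map phi delta) -> box (comp_map phi delta).

(* Main.v *)
Require Import Defs.
From mathcomp Require Import all_boot all_order all_fingroup all_algebra.
From mathcomp Require Import zify.
Import Order.TTheory.

(** Write A for [hat_box].  If f and g are in A, delta is in [box] and
    g f delta is one-to-one, then f delta is one-to-one, hence in [box] because
    f is in A, hence g (f delta) is in [box] because g is in A: so A is closed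
    under composition.  It contains [box] because [box] is itself closed under
    composition and consists of cotransverse maps
    ([box_sub_hat_box_S]), and testing a one-to-one element of A against the
    identity shows that it lies in [box].

    For the bijections, it remains to see that a box map from a cube to itself
    is the identity.  A coface keeps every input coordinate and moves it to the right by 0 or 1
    position.  These displacements add up along a composite, so a box map from
    the m-cube to the n-cube keeps every input coordinate and moves it to the
    right by at most n - m positions ([box_displacement]).  When m = n nothing
    moves.  A symmetry map is a bijection distinct from the identity, and is
    therefore not in A. *)

Lemma comp_mapA {m n p q : nat} (h : cube_map p q) (g : cube_map n p)
    (f : cube_map m n) :
  comp_map h (comp_map g f) = comp_map (comp_map h g) f.
Proof. by apply/ffunP=> x; rewrite !ffunE. Qed.

Lemma comp_map1 {m n : nat} (f : cube_map m n) : comp_map f (id_map m) = f.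
Proof. by apply/ffunP=> x; rewrite !ffunE. Qed.

Lemma comp_map_injr {m n p : nat} (g : cube_map n p) (f : cube_map m n) :
  injective (comp_map g f) -> injective f.
Proof. by move=> gf_inj x y fxy; apply: gf_inj; rewrite !ffunE fxy. Qed.

Lemma tnth_coface_lift {n : nat} (i : 'I_n.+1) (a : bool) (x : cube n)
    (j : 'I_n) :
  tnth (coface i a x) (lift i j) = tnth x j.
Proof. by rewrite ffunE tnth_mktuple liftK. Qed.

Lemma tnth_coface_id {n : nat} (i : 'I_n.+1) (a : bool) (x : cube n) :
  tnth (coface i a x) i = a.
Proof. by rewrite ffunE tnth_mktuple unlift_none. Qed.

Lemma coface_inj {n : nat} (i : 'I_n.+1) (a : bool) : injective (coface i a).
Proof.
move=> x y exy; apply: eq_from_tnth => j.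
by rewrite -(tnth_coface_lift i a x) exy tnth_coface_lift.
Qed.

Lemma le_coface {n : nat} (i : 'I_n.+1) (a : bool) (x y : cube n) :
  (coface i a x <= coface i a y)%O = (x <= y)%O.
Proof.
rewrite !Order.TupleProdOrder.leEtprod; apply/forallP/forallP => le_xy j.
  by have := le_xy (lift i j); rewrite !tnth_coface_lift.
by case: (unliftP i j) => [k|] ->; rewrite ?tnth_coface_lift ?tnth_coface_id.
Qed.

Lemma d1_coface {n : nat} (i : 'I_n.+1) (a : bool) (x y : cube n) :
  d1 (coface i a x) (coface i a y) = d1 x y.
Proof.
rewrite /d1 le_coface; case: ifP => // _; congr Some.
rewrite (bigD1_ord i) //= !tnth_coface_id distnn add0n.
by apply: eq_bigr => j _; rewrite !tnth_coface_lift.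
Qed.

Lemma coface_cotransverse {n : nat} (i : 'I_n.+1) (a : bool) :
  cotransverse (coface i a).
Proof.
split=> x y; last by rewrite d1_coface.
by rewrite !lt_neqAle le_coface (inj_eq (coface_inj i a)).
Qed.

Lemma id_map_cotransverse (n : nat) : cotransverse (id_map n).
Proof. by split=> x y; rewrite !ffunE. Qed.

Lemma cotransverse_comp : closed_under_composition hat_box_S.
Proof.
move=> m n p f g [f_incr f_d1] [g_incr g_d1].
split=> x y xy; rewrite !ffunE.
  exact/g_incr/f_incr.
exact/g_d1/f_d1.
Qed.

Lemma box_sub_hat_box_S : sub_class box hat_box_S.
Proof.
move=> m n f; elim=> {m n f} [n|n i a|m n p f g _ f_cot _ g_cot].
- exact: id_map_cotransverse.
- exact: coface_cotransverse.
- exact: cotransverse_comp f_cot g_cot.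
Qed.

Lemma box_inj {m n : nat} (f : cube_map m n) : box f -> injective f.
Proof.
elim=> {m n f} [n|n i a|m n p f g _ f_inj _ g_inj] x y.
- by rewrite !ffunE.
- exact: coface_inj.
- by rewrite !ffunE => /g_inj /f_inj.
Qed.

(** The bounds on [h] are the part of its strict monotonicity that is stable
    under composition by mere addition, and they force [h j = j] when the two
    cubes have the same dimension. *)
Lemma box_displacement {m n : nat} (f : cube_map m n) :
  box f ->
  exists h : 'I_m -> 'I_n,
    (forall j : 'I_m, j <= h j /\ h j + m <= j + n) /\
    (forall (x : cube m) (j : 'I_m), tnth (f x) (h j) = tnth x j).
Proof.
elim=> {m n f} [n|n i a|m n p f g _ [h [h_le fh]] _ [k [k_le gk]]].
- by exists id; split=> [j|x j] //; rewrite ffunE.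
- exists (lift i); split=> [j|x j]; last exact: tnth_coface_lift.
  by rewrite /= /bump; case: (i <= j); lia.
- exists (k \o h); split=> [j|x j] /=; last by rewrite ffunE gk fh.
  by have := h_le j; have := k_le (h j); lia.
Qed.

Lemma box_endo_id {n : nat} (f : cube_map n n) : box f -> f = id_map n.
Proof.
move=> /box_displacement[h [h_le fh]].
apply/ffunP=> x; rewrite ffunE; apply: eq_from_tnth => j.
have hj : h j = j by apply: val_inj => /=; have := h_le j; lia.
by rewrite -(fh x j) hj.
Qed.

Lemma hat_box_comp : closed_under_composition hat_box.
Proof.
move=> m n p f g [f_cot f_box] [g_cot g_box].
split; first exact: cotransverse_comp f_cot g_cot.
move=> q delta delta_box; rewrite -comp_mapA => gfd_inj.
apply: g_box => //; apply: f_box => //.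
exact: comp_map_injr gfd_inj.
Qed.

Lemma box_sub_hat_box : sub_class box hat_box.
Proof.
move=> m n f f_box; split; first exact: box_sub_hat_box_S.
by move=> p delta delta_box _; apply: box_comp.
Qed.

Lemma hat_box_inj_box {m n : nat} (phi : cube_map m n) :
  hat_box phi -> injective phi -> box phi.
Proof.
move=> [_ phi_box]; have := phi_box m (id_map m) (box_id m).
by rewrite comp_map1.
Qed.

Lemma hat_box_bij_id {n : nat} (phi : cube_map n n) :
  hat_box phi -> bijective phi -> phi = id_map n.
Proof.
by move=> phi_hat /bij_inj phi_inj; apply/box_endo_id/hat_box_inj_box.
Qed.

Lemma symmetry_map_bij {n : nat} (i : 'I_n.+1) : bijective (symmetry_map i).
Proof.
suff symK : involutive (symmetry_map i) by exists (symmetry_map i).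
move=> x; apply: eq_from_tnth => k.
by rewrite !ffunE !tnth_mktuple tpermK.
Qed.

Lemma symmetry_map_neq_id {n : nat} (i : 'I_n.+1) :
  symmetry_map i <> id_map n.+2.
Proof.
set w := widen_ord (leqnSn n.+1) i.
(* The symmetry carries the unique 1 of this vertex from position i to
   position i+1, where the vertex itself has a 0. *)
move=> /ffunP/(_ ([tuple k == w | k < n.+2] : cube n.+2)).
rewrite !ffunE => /(congr1 (fun y : cube n.+2 => tnth y (lift ord0 i))).
rewrite !tnth_mktuple tpermR eqxx => /esym/eqP/(congr1 val) /=.
by rewrite /bump /=; lia.
Qed.

Theorem proposition2p13 :
  closed_under_composition hat_box /\
  contains_identities hat_box /\
  sub_class box hat_box /\
  sub_class hat_box hat_box_S /\
  category_of_cubes hat_box /\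
  (forall (m n : nat) (phi : cube_map m n),
     hat_box phi /\ injective phi <-> box phi) /\
  (forall (n : nat) (phi : cube_map n n),
     hat_box phi /\ bijective phi <-> phi = id_map n) /\
  (forall (n : nat) (i : 'I_n.+1), ~ hat_box (symmetry_map i)).
Proof.
have hat_box_id : contains_identities hat_box.
  by move=> n; apply: box_sub_hat_box; apply: box_id.
have hat_box_S_sup : sub_class hat_box hat_box_S by move=> m n f [].
split; first exact: hat_box_comp.
split; first exact: hat_box_id.
split; first exact: box_sub_hat_box.
split; first exact: hat_box_S_sup.
split.
  by split; [exact: hat_box_id | exact: hat_box_comp
           | exact: box_sub_hat_box | exact: hat_box_S_sup].
split=> [m n phi|].
  split=> [[phi_hat phi_inj]|phi_box]; first exact: hat_box_inj_box.
  by split; [exact: box_sub_hat_box | exact: box_inj].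
split=> [n phi|n i sym_hat].
  split=> [[phi_hat phi_bij]|->]; first exact: hat_box_bij_id.
  by split; [exact: hat_box_id | exists id => x; rewrite ffunE].
exact/(symmetry_map_neq_id i)/hat_box_bij_id/symmetry_map_bij.
Qed.
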